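(* Let $A\in\mathbb{R}^{m\times n}$ with $A\neq 0$, $B\in\mathbb{R}^{m\times p}$, and let $I_\le, I_=$ be disjoint sets partitioning $\{1,\dots,m\}$. Suppose that the system $$a_i^TX\le b_i^T\ (i\in I_\le),\qquad a_i^TX=b_i^T\ (i\in I_=)$$ in the unknown $X\in\mathbb{R}^{n\times p}$ has a nonempty feasible region $\Omega$. Let $T=\{\tau_1,\dots,\tau_{m'}\}$ be a partition of $I_\le$, $T'=\{\tau_{m'+1},\dots,\tau_{m''}\}$ a partition of $I_=$, and let step sizes $0<t_\tau<2$ be given for $\tau\in T\cup T'$. Then for any initial $X^0\in\mathbb{R}^{n\times p}$ the sequence of iterates $\{X^k\}_{k\ge0}$ generated by the B-MRK algorithm (described in the context) converges linearly in expectation: for each $k\ge 0$, $$\mathbb{E}\left[d(X^{k+1},\Omega)^2\,\middle|\,X^k\right]\le\left(1-\min_{\tau\in T\cup T'}2t_\tau\left(1-\frac{t_\tau}{2}\right)\frac{1}{L^2\|A\|_F^2}\right)d(X^k,\Omega)^2,$$ where $L>0$ is the Hoffman constant of the system, i.e. the smallest constant such that $d(X,\Omega)\le L\,\|c_M(AX-B)\|_F$ for all $X\in\mathbb{R}^{n\times p}$.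
   Context: $a_i^T$ and $b_i^T$ denote the $i$-th rows of $A$ and $B$; inequalities between row vectors are entrywise. $\|\cdot\|_F$ is the Frobenius norm and $d(X,\Omega)=\min_{Y\in\Omega}\|X-Y\|_F$. The function $c_M:\mathbb{R}^{m\times p}\to\mathbb{R}^{m\times p}$ is defined by $c_M(Y)_{ij}=\max\{Y_{ij},0\}$ if $i\in I_\le$ and $c_M(Y)_{ij}=Y_{ij}$ if $i\in I_=$. For a matrix $M$, $(M)_+$ is the entrywise maximum of $M$ and $0$. For an index set $\tau\subseteq\{1,\dots,m\}$, $A_\tau$ and $B_\tau$ denote the submatrices of $A$ and $B$ formed by the rows indexed by $\tau$. B-MRK algorithm: given $X^0$, at each iteration $k=0,1,2,\dots$ sample (independently of the past) a block $\tau\in T\cup T'$ with probability $p_\tau=\|A_\tau\|_F^2/\|A\|_F^2$ (so blocks with $A_\tau=0$ are never selected), and set $$X^{k+1}=X^k-t_\tau\frac{A_\tau^T(A_\tau X^k-B_\tau)_+}{\|A_\tau\|_F^2}\ \text{ if }\tau\in T,\qquad X^{k+1}=X^k-t_\tau\frac{A_\tau^T(A_\tau X^k-B_\tau)}{\|A_\tau\|_F^2}\ \text{ if }\tau\in T'.$$ *)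

(* Defs.v *)
From HB Require Import structures.
From mathcomp Require Import all_boot all_order all_algebra.
From mathcomp Require Import all_classical all_reals all_analysis.

Set Implicit Arguments.
Unset Strict Implicit.
Unset Printing Implicit Defensive.

Import Order.TTheory GRing.Theory Num.Theory.
Import numFieldNormedType.Exports.

Local Open Scope classical_set_scope.
Local Open Scope ring_scope.

(* The norm of the library on matrices is the max norm, hence this one. *)
Definition frob (R : realType) (m n : nat) (M : 'M[R]_(m, n)) : R :=
  Num.sqrt (\sum_i \sum_j M i j ^+ 2).

(* For a nonempty closed S the infimum is a minimum. *)
Definition frob_dist (R : realType) (n p : nat) (X : 'M[R]_(n, p))
    (S : set 'M[R]_(n, p)) : R :=
  inf [set frob (X - Y) | Y in S].

Definition posmx (R : realType) (m n : nat) (M : 'M[R]_(m, n)) :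
    'M[R]_(m, n) :=
  map_mx (fun x => Num.max x 0) M.

Definition rows_of (R : realType) (m n : nat) (tau : {set 'I_m})
    (M : 'M[R]_(m, n)) : 'M[R]_(#|tau|, n) :=
  rowsub (fun i : 'I_#|tau| => enum_val i) M.

Definition feasible (R : realType) (m n p : nat) (A : 'M[R]_(m, n))
    (B : 'M[R]_(m, p)) (Ile Ieq : {set 'I_m}) : set 'M[R]_(n, p) :=
  [set X | (forall i, i \in Ile ->
              forall j, (row i A *m X) 0 j <= (row i B) 0 j) /\
           (forall i, i \in Ieq -> row i A *m X = row i B)].

(* Rows outside Ile are left unchanged; they are the rows of the equality
   constraints, since Ile and Ieq partition the set of rows. *)
Definition cM (R : realType) (m p : nat) (Ile : {set 'I_m})
    (Y : 'M[R]_(m, p)) : 'M[R]_(m, p) :=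
  \matrix_(i, j) if i \in Ile then Num.max (Y i j) 0 else Y i j.

Definition hoffman_bound (R : realType) (m n p : nat) (A : 'M[R]_(m, n))
    (B : 'M[R]_(m, p)) (Ile Ieq : {set 'I_m}) (C : R) : Prop :=
  forall X : 'M[R]_(n, p),
    frob_dist X (feasible A B Ile Ieq) <= C * frob (cM Ile (A *m X - B)).

Definition is_hoffman_constant (R : realType) (m n p : nat)
    (A : 'M[R]_(m, n)) (B : 'M[R]_(m, p)) (Ile Ieq : {set 'I_m}) (L : R) :
    Prop :=
  [/\ 0 < L, hoffman_bound A B Ile Ieq L
    & forall C, hoffman_bound A B Ile Ieq C -> L <= C].

(* The last branch is a null event for the sampling below. When A_tau = 0 the
   increment is 0. *)
Definition bmrk_step (R : realType) (m n p : nat) (A : 'M[R]_(m, n))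
    (B : 'M[R]_(m, p)) (T T' : {set {set 'I_m}}) (t : {set 'I_m} -> R)
    (tau : {set 'I_m}) (X : 'M[R]_(n, p)) : 'M[R]_(n, p) :=
  let At := rows_of tau A in
  let Bt := rows_of tau B in
  if tau \in T then
    X - (t tau / frob At ^+ 2) *: (At^T *m posmx (At *m X - Bt))
  else if tau \in T' then
    X - (t tau / frob At ^+ 2) *: (At^T *m (At *m X - Bt))
  else X.

Fixpoint bmrk (R : realType) (m n p : nat) (A : 'M[R]_(m, n))
    (B : 'M[R]_(m, p)) (T T' : {set {set 'I_m}}) (t : {set 'I_m} -> R)
    (X0 : 'M[R]_(n, p)) (s : nat -> {set 'I_m}) (k : nat) : 'M[R]_(n, p) :=
  if k is k'.+1 then bmrk_step A B T T' t (s k') (bmrk A B T T' t X0 s k')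
  else X0.

(* tau k is the block drawn at iteration k. As these random variables take
   finitely many values, independence of tau k from (tau i)_(i < k) is the
   product rule on atoms. Blocks outside T :|: T' have total probability 0,
   because the probabilities prescribed here add up to 1. *)
Definition bmrk_sampling (R : realType) (d : measure_display)
    (W : measurableType d) (P : probability W R) (m n : nat)
    (A : 'M[R]_(m, n)) (T T' : {set {set 'I_m}})
    (tau : nat -> W -> {set 'I_m}) : Prop :=
  [/\ forall k s, measurable [set w | tau k w = s],
      forall k s, s \in T :|: T' ->
        P [set w | tau k w = s] = (frob (rows_of s A) ^+ 2 / frob A ^+ 2)%:E
    & forall k s (past : nat -> {set 'I_m}),
        P ([set w | tau k w = s] `&`
           [set w | forall i, (i < k)%N -> tau i w = past i]) =
        (P [set w | tau k w = s] *
         P [set w | forall i, (i < k)%N -> tau i w = past i])%E].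

(* The sigma-algebra generated by a random matrix, for the Borel sets of its
   codomain. *)
Definition sigma_of (R : realType) (W : Type) (n p : nat)
    (X : W -> 'M[R]_(n, p)) : set (set W) :=
  preimage_set_system setT X <<s [set U : set 'M[R]_(n, p) | open U] >>.

(* V is a version of the conditional expectation of Z given the
   sub-sigma-algebra G. *)
Definition is_cond_expectation (R : realType) (d : measure_display)
    (W : measurableType d) (P : probability W R) (G : set (set W))
    (Z V : W -> R) : Prop :=
  [/\ P.-integrable setT (EFin \o Z),
      P.-integrable setT (EFin \o V),
      forall S : set R, measurable S -> G (V @^-1` S)
    & forall E, G E ->
        (\int[P]_(w in E) (V w)%:E = \int[P]_(w in E) (Z w)%:E)%E].

(* The infimum ranges over a finite nonempty set as soon as T :|: T' covers
   a nonempty set of rows, so that it is a minimum. *)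
Definition bmrk_gain (R : realType) (m n : nat) (A : 'M[R]_(m, n))
    (T T' : {set {set 'I_m}}) (t : {set 'I_m} -> R) (L : R) : R :=
  inf [set 2 * t s * (1 - t s / 2) * (1 / (L ^+ 2 * frob A ^+ 2))
      | s in [set s | s \in T :|: T']].

(* Main.v *)
Require Import Defs.
From HB Require Import structures.
From mathcomp Require Import all_boot all_order all_algebra.
From mathcomp Require Import all_classical all_reals all_analysis.
From mathcomp Require Import ring lra.

Import Order.TTheory GRing.Theory Num.Theory.
Import numFieldNormedType.Exports.
Local Open Scope classical_set_scope.
Local Open Scope ring_scope.

Set Implicit Arguments.
Unset Strict Implicit.
Unset Printing Implicit Defensive.

(** One step with block s replaces X by X - (t_s / |A_s|^2) A_s^T r_s, where
    r_s consists of the rows in s of the violation cM (A X - B).  Let Y be any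
    feasible matrix.  Feasibility of Y gives <A_s (X - Y), r_s> >= |r_s|^2:
    on an equality row A Y = B, and on an inequality row the slack of Y is
    multiplied by a positive part.  Expanding the square and using
    |A_s^T r_s| <= |A_s| |r_s|, the squared distance to Y drops by at least
    t_s (2 - t_s) |r_s|^2 / |A_s|^2 ([relaxed_step_descent]).  Since Y is
    arbitrary, the infimum over Y gives the same drop for the squared distance
    to the feasible set, and no projection onto that set has to be constructed
    ([block_step_dist]).

    Averaging with weights |A_s|^2 / |A|^2 cancels the |A_s|^2.  The blocks
    partition the rows, so the |r_s|^2 add up to |cM (A X - B)|^2, which the
    Hoffman bound estimates from below by d(X, Omega)^2 / L^2
    ([bmrk_expected_descent]).

    It remains to identify the conditional expectation.  The iterate X^k is a
    function of the first k blocks, hence takes finitely many values and is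
    independent of the block drawn at step k.  So conditioning on X^k amounts
    to freezing X^k and averaging over the block ([freezing]).  A version V of
    the conditional expectation is measurable for the sigma-algebra of X^k, so
    it is constant on each set {X^k = x}; integrating over these atoms
    determines V almost everywhere ([freezing_unique]). *)

(** * The Frobenius norm *)

Lemma frob_ge0 (R : realType) (m n : nat) (M : 'M[R]_(m, n)) : 0 <= frob M.
Proof. exact: sqrtr_ge0. Qed.

Lemma frob_sqr (R : realType) (m n : nat) (M : 'M[R]_(m, n)) :
  frob M ^+ 2 = \sum_i \sum_j M i j ^+ 2.
Proof.
by rewrite sqr_sqrtr//; do 2![apply: sumr_ge0 => ? _]; exact: sqr_ge0.
Qed.

Lemma frob_eq0 (R : realType) (m n : nat) (M : 'M[R]_(m, n)) :
  (frob M == 0) = (M == 0).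
Proof.
apply/idP/eqP => [M0|->]; last first.
  rewrite -sqrf_eq0 frob_sqr; apply/eqP.
  by do 2![apply: big1 => ? _]; rewrite mxE expr0n.
have sq0 i : 0 <= \sum_j M i j ^+ 2 by apply: sumr_ge0 => j _; exact: sqr_ge0.
apply/matrixP => i j; rewrite mxE; apply/eqP; rewrite -sqrf_eq0.
move: M0; rewrite -sqrf_eq0 frob_sqr psumr_eq0// => /allP/(_ i (mem_index_enum _)).
rewrite psumr_eq0 => [/allP/(_ j (mem_index_enum _))//|j' _]; exact: sqr_ge0.
Qed.

Definition frob_dot (R : realType) (m n : nat) (M N : 'M[R]_(m, n)) : R :=
  \sum_i \sum_j M i j * N i j.

Lemma frob_dot_mulmx_tr (R : realType) (q n p : nat) (M : 'M[R]_(q, n))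
    (D : 'M[R]_(n, p)) (r : 'M[R]_(q, p)) :
  frob_dot D (M^T *m r) = frob_dot (M *m D) r.
Proof.
transitivity (\sum_i \sum_j \sum_k D i j * (M k i * r k j)).
  apply: eq_bigr => i _; apply: eq_bigr => j _; rewrite mxE mulr_sumr.
  by apply: eq_bigr => k _; rewrite mxE.
under eq_bigr => i _ do rewrite exchange_big.
rewrite exchange_big; apply: eq_bigr => k _ /=.
rewrite exchange_big; apply: eq_bigr => j _ /=.
by rewrite mxE mulr_suml; apply: eq_bigr => i _; ring.
Qed.

Lemma frob_sqrB (R : realType) (m n : nat) (M N : 'M[R]_(m, n)) (c : R) :
  frob (M - c *: N) ^+ 2 =
  frob M ^+ 2 - 2 * c * frob_dot M N + c ^+ 2 * frob N ^+ 2.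
Proof.
rewrite !frob_sqr /frob_dot !mulr_sumr -sumrB -big_split; apply: eq_bigr => i _ /=.
rewrite !mulr_sumr -sumrB -big_split; apply: eq_bigr => j _ /=.
by rewrite !mxE; ring.
Qed.

Lemma sqr_sum_mul_le (R : realType) (I : finType) (a b : I -> R) :
  (\sum_i a i * b i) ^+ 2 <= (\sum_i a i ^+ 2) * (\sum_i b i ^+ 2).
Proof.
(* Lagrange: the doubled difference is the sum of the squares
   (a i * b j - a j * b i) ^+ 2. *)
have le2 : 2 * (\sum_i a i * b i) ^+ 2 <=
    2 * ((\sum_i a i ^+ 2) * (\sum_i b i ^+ 2)).
  have -> : 2 * ((\sum_i a i ^+ 2) * (\sum_i b i ^+ 2)) =
      \sum_i \sum_j (a i ^+ 2 * b j ^+ 2 + a j ^+ 2 * b i ^+ 2).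
    under [RHS]eq_bigr do rewrite big_split.
    rewrite big_split /= [X in _ = _ + X]exchange_big /= big_distrlr /=; ring.
  rewrite expr2 big_distrlr /= mulr_sumr; apply: ler_sum => i _.
  rewrite mulr_sumr; apply: ler_sum => j _.
  by have := sqr_ge0 (a i * b j - a j * b i); lra.
by rewrite ler_pM2l in le2.
Qed.

(** Submultiplicativity: Cauchy-Schwarz for each entry of the product. *)
Lemma frob_mulmx_tr_le (R : realType) (q n p : nat) (M : 'M[R]_(q, n))
    (r : 'M[R]_(q, p)) :
  frob (M^T *m r) ^+ 2 <= frob M ^+ 2 * frob r ^+ 2.
Proof.
rewrite !frob_sqr [X in _ <= X * _]exchange_big.
rewrite [X in _ <= _ * X]exchange_big /= big_distrlr /=.
apply: ler_sum => i _; apply: ler_sum => j _; rewrite mxE.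
rewrite (eq_bigr (fun k => M k i * r k j)) => [|k _]; last by rewrite mxE.
exact: sqr_sum_mul_le.
Qed.

(** * A relaxed step towards one block of constraints *)

(** The squared distance expands to
    |D|^2 - 2 c <M D, r> + c^2 |M^T r|^2 with c = t / |M|^2, and the
    hypothesis on r and submultiplicativity bound the last two terms by
    - c (2 - t) |r|^2.  Stated after multiplication by |M|^2, the estimate also
    holds for M = 0: then the hypothesis forces r = 0. *)
Lemma relaxed_step_descent (R : realType) (q n p : nat) (M : 'M[R]_(q, n))
    (D : 'M[R]_(n, p)) (r : 'M[R]_(q, p)) (t : R) :
  0 < t < 2 -> frob r ^+ 2 <= frob_dot (M *m D) r ->
  frob M ^+ 2 * frob (D - (t / frob M ^+ 2) *: (M^T *m r)) ^+ 2
    + t * (2 - t) * frob r ^+ 2 <= frob M ^+ 2 * frob D ^+ 2.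
Proof.
move=> /andP[t0 t2] hr.
have [M0|M0] := eqVneq (frob M ^+ 2) 0.
  have r0 : frob r ^+ 2 = 0.
    apply/le_anti; rewrite sqr_ge0 andbT (le_trans hr)// /frob_dot.
    move: M0 => /eqP; rewrite sqrf_eq0 frob_eq0 => /eqP ->.
    by rewrite big1// => i _; apply: big1 => j _; rewrite mul0mx mxE mul0r.
  by rewrite M0 r0 mulr0 !mul0r addr0.
have Mp : 0 < frob M ^+ 2 by rewrite lt_neqAle eq_sym M0 sqr_ge0.
rewrite frob_sqrB frob_dot_mulmx_tr.
have := frob_mulmx_tr_le M r.
move: (frob M ^+ 2) (frob r ^+ 2) (frob_dot _ _) (frob D ^+ 2) (frob (_ *m _) ^+ 2)
  M0 Mp hr => a b f e g a0 ap hr hg.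
have -> : a * (e - 2 * (t / a) * f + (t / a) ^+ 2 * g) =
  a * e - 2 * t * f + t ^+ 2 * (g / a) by field.
have ga : g / a <= b by rewrite ler_pdivrMr// mulrC.
have := ler_wpM2l (ltW t0) hr.
have := ler_wpM2l (sqr_ge0 t) ga.
nra.
Qed.

(** * The distance to a set *)

Lemma frob_dist_le (R : realType) (n p : nat) (X Y : 'M[R]_(n, p))
    (S : set 'M[R]_(n, p)) : S Y -> frob_dist X S <= frob (X - Y).
Proof.
move=> SY; apply: ge_inf; last by exists Y.
by exists 0 => _ [Z _ <-]; exact: frob_ge0.
Qed.

Lemma frob_dist_ge0 (R : realType) (n p : nat) (X : 'M[R]_(n, p))
    (S : set 'M[R]_(n, p)) : S !=set0 -> 0 <= frob_dist X S.
Proof.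
move=> [Y SY]; apply: lb_le_inf; first by exists (frob (X - Y)), Y.
by move=> _ [Z _ <-]; exact: frob_ge0.
Qed.

(** Transfers a lower bound on all squared distances to points of S to the
    squared infimum; it replaces the choice of a nearest point. *)
Lemma le_sqr_frob_dist (R : realType) (n p : nat) (X : 'M[R]_(n, p))
    (S : set 'M[R]_(n, p)) (c K : R) : S !=set0 -> 0 <= c ->
  (forall Y, S Y -> K <= c * frob (X - Y) ^+ 2) ->
  K <= c * frob_dist X S ^+ 2.
Proof.
move=> [Y0 SY0]; rewrite le_eqVlt => /predU1P[<- /(_ _ SY0)|c0 hK].
  by rewrite !mul0r.
rewrite mulrC -ler_pdivrMr//.
have sqrt_le : Num.sqrt (K / c) <= frob_dist X S.
  apply: lb_le_inf; first by exists (frob (X - Y0)), Y0.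
  move=> _ [Y SY <-]; rewrite -[leRHS]ger0_norm ?frob_ge0// -sqrtr_sqr.
  by apply: ler_wsqrtr; rewrite ler_pdivrMr// mulrC; exact: hK.
have [Kc0|/ltW Kc0] := leP 0 (K / c); last exact: le_trans Kc0 (sqr_ge0 _).
rewrite -[leLHS]sqr_sqrtr// ler_sqr ?nnegrE ?sqrtr_ge0//.
by rewrite (le_trans _ sqrt_le) ?sqrtr_ge0.
Qed.

(** * Row blocks *)

Lemma frob_sqr_rows_of (R : realType) (m n : nat) (s : {set 'I_m})
    (M : 'M[R]_(m, n)) :
  frob (rows_of s M) ^+ 2 = \sum_(i in s) \sum_j M i j ^+ 2.
Proof.
rewrite frob_sqr [RHS]big_enum_val.
by apply: eq_bigr => i _; apply: eq_bigr => j _; rewrite mxE.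
Qed.

Lemma rows_of_mulmx (R : realType) (m n p : nat) (s : {set 'I_m})
    (A : 'M[R]_(m, n)) (D : 'M[R]_(n, p)) :
  rows_of s A *m D = rows_of s (A *m D).
Proof.
by apply/matrixP => i j; rewrite !mxE; apply: eq_bigr => k _; rewrite !mxE.
Qed.

Lemma partition_setU (T : finType) (P P' : {set {set T}}) (D D' : {set T}) :
  [disjoint D & D']%B -> finset.partition P D -> finset.partition P' D' ->
  finset.partition (P :|: P') (D :|: D').
Proof.
move=> dD /and3P[/eqP cP tP nP] /and3P[/eqP cP' tP' nP'].
apply/and3P; split.
- by rewrite /finset.cover finset.bigcup_setU -/(finset.cover P) -/(finset.cover P') cP cP'.
- by apply: finset.trivIsetU => //; rewrite cP cP'.
- by rewrite inE negb_or nP.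
Qed.

(** * Expected descent of one iteration from a fixed matrix *)

Section block_step.
Context (R : realType) (m n p : nat).
Variables (A : 'M[R]_(m, n)) (B : 'M[R]_(m, p)) (Ile Ieq : {set 'I_m}).
Variables (T T' : {set {set 'I_m}}) (t : {set 'I_m} -> R).
Hypotheses (hdisj : [disjoint Ile & Ieq]%B)
  (hcover : Ile :|: Ieq = [set: 'I_m]%SET)
  (hT : finset.partition T Ile) (hT' : finset.partition T' Ieq).

Let Omega : set 'M[R]_(n, p) := feasible A B Ile Ieq.

(** Inequality and equality blocks take the same form once the residual is read
    off cM: the positive part is applied exactly on the rows of Ile, and a
    block of T (resp. T') has all its rows in Ile (resp. outside Ile). *)
Lemma bmrk_stepE (s : {set 'I_m}) (X : 'M[R]_(n, p)) : s \in T :|: T' ->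
  bmrk_step A B T T' t s X =
  X - (t s / frob (rows_of s A) ^+ 2) *:
    ((rows_of s A)^T *m rows_of s (cM Ile (A *m X - B))).
Proof.
rewrite inE /bmrk_step; case: ifPn => sT /=.
  move=> _; congr (_ - _ *: (_ *m _)).
  apply/matrixP => i j; rewrite rows_of_mulmx !mxE.
  suff -> : enum_val i \in Ile by [].
  have /and3P[/eqP <- _ _] := hT; apply/bigcupP; exists s => //.
  exact: enum_valP.
move=> sT'; rewrite sT'; congr (_ - _ *: (_ *m _)).
apply/matrixP => i j; rewrite rows_of_mulmx !mxE.
suff -> : enum_val i \in Ile = false by [].
have : enum_val i \in Ieq.
  have /and3P[/eqP <- _ _] := hT'; apply/bigcupP; exists s => //.
  exact: enum_valP.
by apply: contraTF => iI; rewrite (disjointFr hdisj iI).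
Qed.

(** Entrywise, with u the entry of A X - B and v <= 0 that of A Y - B, this is
    max(u, 0)^2 <= (u - v) max(u, 0) on an inequality row; on an equality row
    v = 0 and both sides are u^2. *)
Lemma residual_frob_dot (X Y : 'M[R]_(n, p)) (s : {set 'I_m}) : Omega Y ->
  frob (rows_of s (cM Ile (A *m X - B))) ^+ 2 <=
  frob_dot (rows_of s A *m (X - Y)) (rows_of s (cM Ile (A *m X - B))).
Proof.
move=> [Yle Yeq]; rewrite frob_sqr.
apply: ler_sum => i _; apply: ler_sum => j _.
rewrite rows_of_mulmx mulmxBr !mxE; set k := enum_val i.
have rowE (Z : 'M[R]_(n, p)) : (row k A *m Z) 0 j = \sum_l A k l * Z l j.
  by rewrite mxE; apply: eq_bigr => l _; rewrite mxE.
have rowB : row k B 0 j = B k j by rewrite mxE.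
case: ifPn => kI.
  have := Yle _ kI j; rewrite rowE rowB.
  move: (\sum_l _) (\sum_l _) (B k j) => x y b yb.
  case: (leP (x - b) 0) => [|xb]; nra.
have kE : k \in Ieq by move: (finset.in_setT k); rewrite -hcover inE (negbTE kI).
have := congr1 (fun v : 'rV_p => v 0 j) (Yeq _ kE); rewrite rowE rowB => ->.
by rewrite expr2.
Qed.

(** The descent estimate holds for the distance to every feasible Y, and the
    stepped point is compared with the same Y, so the infimum can be taken on
    the right. *)
Lemma block_step_dist (s : {set 'I_m}) (X : 'M[R]_(n, p)) :
  Omega !=set0 -> s \in T :|: T' -> 0 < t s < 2 ->
  frob (rows_of s A) ^+ 2 * frob_dist (bmrk_step A B T T' t s X) Omega ^+ 2
    + t s * (2 - t s) * frob (rows_of s (cM Ile (A *m X - B))) ^+ 2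
  <= frob (rows_of s A) ^+ 2 * frob_dist X Omega ^+ 2.
Proof.
move=> hO sT ht; apply: le_sqr_frob_dist => // [|Y OY]; first exact: sqr_ge0.
apply: le_trans (relaxed_step_descent ht (residual_frob_dot X s OY)).
rewrite lerD2r; apply: ler_wpM2l; first exact: sqr_ge0.
have -> : X - Y - (t s / frob (rows_of s A) ^+ 2) *:
    ((rows_of s A)^T *m rows_of s (cM Ile (A *m X - B))) =
    bmrk_step A B T T' t s X - Y by rewrite bmrk_stepE// addrAC.
by rewrite ler_sqr ?nnegrE ?frob_ge0 ?frob_dist_ge0// frob_dist_le.
Qed.

Lemma sum_blocks_frob_sqr q (M : 'M[R]_(m, q)) :
  \sum_(s in T :|: T') frob (rows_of s M) ^+ 2 = frob M ^+ 2.
Proof.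
under eq_bigr do rewrite frob_sqr_rows_of.
rewrite -(set_partition_big _ (partition_setU hdisj hT hT')) hcover frob_sqr.
by apply: eq_bigl => i; rewrite inE.
Qed.

(** The weights |A_s|^2 / |A|^2 are proportional to the denominators of the
    descent estimates, so the average decrease is at least
    g L^2 times the sum over s of |r_s|^2, where g is the gain; this sum is the
    whole squared violation, to which the Hoffman bound applies. *)
Lemma bmrk_expected_descent (L : R) (X : 'M[R]_(n, p)) :
  A != 0 -> Omega !=set0 -> (forall s, s \in T :|: T' -> 0 < t s < 2) ->
  0 < L -> hoffman_bound (p := p) A B Ile Ieq L ->
  \sum_(s in T :|: T') frob (rows_of s A) ^+ 2 / frob A ^+ 2 *
      frob_dist (bmrk_step A B T T' t s X) Omega ^+ 2 <=
  (1 - bmrk_gain A T T' t L) * frob_dist X Omega ^+ 2.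
Proof.
move=> hA hO ht L0 hL.
have a0 : 0 < frob A ^+ 2.
  by rewrite exprn_gt0// lt_neqAle frob_ge0 eq_sym frob_eq0 hA.
have nL : L != 0 by rewrite gt_eqF.
have nA : frob A != 0 by rewrite frob_eq0.
set g := bmrk_gain _ _ _ _ _; set r := cM Ile (A *m X - B).
set dX := frob_dist X Omega.
have term_ge0 u : u \in T :|: T' ->
    0 <= 2 * t u * (1 - t u / 2) * (1 / (L ^+ 2 * frob A ^+ 2)).
  move=> /ht /andP[u0 u2]; apply: mulr_ge0; first by apply: mulr_ge0; lra.
  by rewrite divr_ge0// mulr_ge0// sqr_ge0.
have gP s : s \in T :|: T' -> g * (L ^+ 2 * frob A ^+ 2) <= t s * (2 - t s).
  move=> sT; rewrite -ler_pdivlMr; last by rewrite mulr_gt0// exprn_gt0.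
  have -> : t s * (2 - t s) / (L ^+ 2 * frob A ^+ 2) =
      2 * t s * (1 - t s / 2) * (1 / (L ^+ 2 * frob A ^+ 2)).
    by field; rewrite nL nA.
  apply: ge_inf; last by exists s.
  by exists 0 => _ [u uT <-]; exact: term_ge0.
(* The infimum defining g is over a nonempty set: without blocks A would
   vanish. *)
have g0 : 0 <= g.
  have [[u uT]|noT] := pselect (exists u, u \in T :|: T'); last first.
    suff A0 : frob A ^+ 2 = 0 by rewrite A0 ltxx in a0.
    rewrite -sum_blocks_frob_sqr; apply: big1 => v vT.
    by case: noT; exists v.
  apply: lb_le_inf.
    by exists (2 * t u * (1 - t u / 2) * (1 / (L ^+ 2 * frob A ^+ 2))), u.
  by move=> _ [v vT <-]; exact: term_ge0.
have dL : dX ^+ 2 <= L ^+ 2 * frob r ^+ 2.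
  rewrite -exprMn lerXn2r ?nnegrE//; first exact: frob_dist_ge0.
    by rewrite mulr_ge0 ?frob_ge0// ltW.
  exact: hL.
rewrite -(ler_pM2l a0) mulr_sumr.
have blockE s : frob A ^+ 2 * (frob (rows_of s A) ^+ 2 / frob A ^+ 2 *
      frob_dist (bmrk_step A B T T' t s X) Omega ^+ 2) =
    frob (rows_of s A) ^+ 2 * frob_dist (bmrk_step A B T T' t s X) Omega ^+ 2.
  by field.
under eq_bigr do rewrite blockE.
apply: (@le_trans _ _ (\sum_(s in T :|: T') (frob (rows_of s A) ^+ 2 * dX ^+ 2 -
    g * (L ^+ 2 * frob A ^+ 2) * frob (rows_of s r) ^+ 2))).
  apply: ler_sum => s sT; have := block_step_dist X hO sT (ht _ sT).
  have := ler_wpM2r (sqr_ge0 (frob (rows_of s r))) (gP _ sT).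
  rewrite -/r -/dX; lra.
rewrite sumrB -mulr_suml -mulr_sumr !sum_blocks_frob_sqr.
have := ler_wpM2l (mulr_ge0 g0 (ltW a0)) dL; lra.
Qed.

End block_step.

(** * Random variables with values in a finite type *)

Section finite_valued.
Context (d : measure_display) (W : measurableType d) (R : realType).
Variables (P : probability W R) (T : finType) (Y : W -> T).
Hypothesis mY : forall y, measurable [set w | Y w = y].

Lemma measurable_fiber_union (D : set T) : measurable (Y @^-1` D).
Proof.
have -> : Y @^-1` D = \bigcup_(y in D) [set w | Y w = y].
  apply/seteqP; split => [w Dw|w [y Dy /= wy]]; first by exists (Y w).
  by rewrite wy.
by apply: fin_bigcup_measurable => // y _; exact: mY.
Qed.

Lemma measurable_fun_finite_valued (D : set W) (f : T -> R) :
  measurable_fun D (f \o Y).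
Proof.
move=> mD S mS; rewrite comp_preimage.
by apply: measurableI => //; exact: measurable_fiber_union.
Qed.

Lemma integrable_finite_valued (f : T -> R) :
  P.-integrable setT (EFin \o (f \o Y)).
Proof.
apply: measurable_bounded_integrable => //.
- exact: le_lt_trans (probability_le1 P measurableT) (ltry _).
- exact: measurable_fun_finite_valued.
- exists (\sum_y `|f y|); split; first exact: num_real.
  move=> M /ltW leM w _; apply: le_trans leM; rewrite (bigD1 (Y w))//= lerDl.
  by apply: sumr_ge0.
Qed.

Lemma integral_finite_valued (D : set T) (f : T -> R) :
  (\int[P]_(w in Y @^-1` D) (f (Y w))%:E =
   (\sum_(y in D) f y * fine (P [set w | Y w = y]))%:E)%E.
Proof.
have -> : Y @^-1` D =
    \big[setU/set0]_(y <- [seq y <- enum T | y \in D]) [set w | Y w = y].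
  rewrite -bigcup_seq; apply/seteqP; split => [w Dw|w [y /= yD wy]].
    by exists (Y w) => //=; rewrite mem_filter mem_enum andbT; exact: mem_set.
  by move: yD; rewrite mem_filter wy => /andP[/set_mem].
rewrite integral_bigsetU_EFin//=.
- rewrite big_filter big_enum_cond /= -sumEFin.
  apply: eq_bigr => y _.
  rewrite (eq_integral (cst (f y)%:E)) => [|w]; last by rewrite inE /= => ->.
  rewrite integral_cst// EFinM fineK// fin_num_measure//.
- by rewrite filter_uniq// enum_uniq.
- by move=> y y' _ _ [w [/= <- <-]].
- by apply/measurable_realfun.measurable_EFinP; exact: measurable_fun_finite_valued.
Qed.

Lemma probability_finite_valued (D : set T) :
  fine (P (Y @^-1` D)) = \sum_(y in D) fine (P [set w | Y w = y]).
Proof.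
have := integral_finite_valued D (cst 1).
have -> := integral_cst P (measurable_fiber_union D) 1%:E.
by rewrite mul1e => -> /=; apply: eq_bigr => y _; rewrite mul1r.
Qed.

End finite_valued.

(** * Conditioning on a matrix with finitely many values *)

Lemma closed_finite_mx (R : realType) (n p : nat) (S : set 'M[R]_(n, p)) :
  finite_set S -> closed S.
Proof.
move=> finS; have -> : S = \bigcup_(M in S) [set M].
  by rewrite bigcup_imset1 image_id.
apply: closed_bigcup => // M _.
have -> : [set M] = \bigcap_(ij in [set: 'I_n * 'I_p])
    (fun N : 'M[R]_(n, p) => N ij.1 ij.2) @^-1` [set M ij.1 ij.2].
  apply/seteqP; split => [_ -> //|N NM]; apply/matrixP => i j.
  exact: (NM (i, j)).
apply: closed_bigI => ij _; apply: preimage_closed.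
  by move=> N _; exact: coord_continuous.
exact: closed_eq.
Qed.

(** Any set D of values may be replaced by its trace on the finite range of X,
    which is closed, hence Borel. *)
Lemma sigma_of_finite_valued (R : realType) (W : Type) (n p : nat)
    (X : W -> 'M[R]_(n, p)) (D : set 'M[R]_(n, p)) :
  finite_set (range X) -> sigma_of X (X @^-1` D).
Proof.
move=> finX; exists (D `&` range X); last first.
  rewrite setTI; apply/seteqP; split => [w []//|w Dw].
  by split => //; exists w.
have cD : closed (D `&` range X).
  by apply: closed_finite_mx; apply: sub_finite_set finX; exact: subIsetr.
have [_ + _] := smallest_sigma_algebra setT [set U : set 'M[R]_(n, p) | open U].
move=> /(_ (~` (D `&` range X))); rewrite setTD setCK; apply.
by apply: sub_sigma_algebra; exact: closed_openC.
Qed.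

Section freezing.
Context (d : measure_display) (W : measurableType d) (R : realType).
Variables (P : probability W R) (H S : finType) (Pi : W -> H) (sig : W -> S).
Hypotheses (mPi : forall h, measurable [set w | Pi w = h])
  (msig : forall s, measurable [set w | sig w = s])
  (indep : forall h s, P ([set w | sig w = s] `&` [set w | Pi w = h]) =
     (P [set w | sig w = s] * P [set w | Pi w = h])%E).
Variables (n p : nat) (F : H -> 'M[R]_(n, p)) (z : 'M[R]_(n, p) -> S -> R).

Let X (w : W) := F (Pi w).
Let g (x : 'M[R]_(n, p)) := \sum_s fine (P [set w | sig w = s]) * z x s.

Lemma finite_range_X : finite_set (range X).
Proof.
apply: (@sub_finite_set _ _ (range F)); last exact: finite_image.
by move=> _ [w _ <-]; exists (Pi w).
Qed.

(** For an event {X in U}, both integrals are finite sums over the values of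
    (Pi, sig); by independence each term of the one for z splits as a product,
    and summing over the values of sig first produces g. *)
Lemma freezing :
  is_cond_expectation P (sigma_of X) (fun w => z (X w) (sig w)) (g \o X).
Proof.
pose Y w := (Pi w, sig w).
have YE y : [set w | Y w = y] =
    [set w | sig w = y.2] `&` [set w | Pi w = y.1].
  apply/seteqP; split => [w /= <-//|w [/= e1 e2]].
  by rewrite /Y e1 e2; case: y {e1 e2}.
have mY y : measurable [set w | Y w = y] by rewrite YE; exact: measurableI.
split.
- exact: (integrable_finite_valued P mY (fun y => z (F y.1) y.2)).
- exact: (integrable_finite_valued P mPi (fun h => g (F h))).
- move=> B _; rewrite comp_preimage.
  by apply: sigma_of_finite_valued; exact: finite_range_X.
move=> _ [U _ <-]; rewrite setTI.
rewrite -[X @^-1` U]/(Pi @^-1` [set h | U (F h)]).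
rewrite (integral_finite_valued P mPi _ (g \o F)).
rewrite -[Pi @^-1` _]/(Y @^-1` [set y | U (F y.1)]).
rewrite (integral_finite_valued P mY _ (fun y => z (F y.1) y.2)); congr _%:E.
under eq_bigr do rewrite /g /= mulr_suml.
rewrite pair_big /=; apply: eq_big => [y|y _]; last first.
  by rewrite YE indep fineM ?fin_num_measure//; ring.
by rewrite andbT; apply/idP/idP => /set_mem ?; exact: mem_set.
Qed.

(** V factors through X, so on the atom {X = X w} it has the constant value
    V w; both V and g o X have the integral of z over this atom.  Hence V w
    can differ from g (X w) only if the atom is null, and then the fibre of Pi
    through w is null too: such w form a finite union of null fibres. *)
Lemma freezing_unique (V : W -> R) :
  is_cond_expectation P (sigma_of X) (fun w => z (X w) (sig w)) V ->
  {ae P, forall w, V w = g (X w)}.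
Proof.
move=> [_ _ mV intV]; pose N : set H := [set h | P [set w | Pi w = h] = 0%E].
exists (Pi @^-1` N); split.
- exact: measurable_fiber_union.
- rewrite -[LHS]fineK ?fin_num_measure//; last exact: measurable_fiber_union.
  rewrite (probability_finite_valued _ mPi) big1// => h; rewrite inE => /= ->.
  by [].
move=> w /= Vw; set E := X @^-1` [set X w].
have mE : measurable E by exact: (measurable_fiber_union mPi [set h | F h = X w]).
have GE : sigma_of X E by apply: sigma_of_finite_valued; exact: finite_range_X.
suff PE : P E = 0%E.
  apply/eqP; rewrite eq_le measure_ge0 andbT -PE le_measure ?inE//.
  by move=> w' /= e; rewrite /E /X /= e.
have [U _ VU] := mV [set V w] (measurable_set1 _).
have VE w' : E w' -> V w' = V w.
  move=> Ew'; suff : (V @^-1` [set V w]) w' by [].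
  rewrite -VU; split=> //=; rewrite Ew'.
  suff : (setT `&` X @^-1` U) w by case.
  by rewrite VU.
(* Equal integrals of two distinct constants: the atom is null. *)
have cancel (a : \bar R) : a \is a fin_num ->
    ((V w)%:E * a = (g (X w))%:E * a -> a = 0)%E.
  case: a => // r _ [] /eqP; rewrite -subr_eq0 -mulrBl mulf_eq0 subr_eq0.
  by case/predU1P=> [//|/eqP ->].
have [_ _ _ intg] := freezing.
have := etrans (intV _ GE) (esym (intg _ GE)).
rewrite (eq_integral (cst (V w)%:E)) => [|w']; last by rewrite inE => /VE ->.
rewrite [RHS](eq_integral (cst (g (X w))%:E)) => [|w']; last first.
  by rewrite inE /E /= => ->.
rewrite !integral_cst//; apply: cancel; exact: fin_num_measure.
Qed.

End freezing.

(** * The iterates as functions of the past blocks *)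

Lemma eq_bmrk (R : realType) (m n p : nat) (A : 'M[R]_(m, n))
    (B : 'M[R]_(m, p)) (T T' : {set {set 'I_m}}) (t : {set 'I_m} -> R)
    (X0 : 'M[R]_(n, p)) (s s' : nat -> {set 'I_m}) (k : nat) :
  (forall i, (i < k)%N -> s i = s' i) ->
  bmrk A B T T' t X0 s k = bmrk A B T T' t X0 s' k.
Proof.
elim: k => //= k IH ss'; rewrite ss'//; congr bmrk_step.
by apply: IH => i ik; apply: ss'; exact: leqW.
Qed.

(** Turns a word of k letters into an infinite sequence, the form in which
    [bmrk] and [bmrk_sampling] take their blocks. *)
Definition extend_word (S : Type) (s0 : S) (k : nat) (h : 'I_k -> S) (i : nat) :
  S := if insub i is Some j then h j else s0.

Lemma extend_wordE (S : Type) (s0 : S) (k : nat) (h : 'I_k -> S) (i : 'I_k) :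
  extend_word s0 h i = h i.
Proof. by rewrite /extend_word valK. Qed.

Section sampling.
Context (d : measure_display) (W : measurableType d) (R : realType).
Variables (P : probability W R) (m n : nat) (A : 'M[R]_(m, n)).
Variables (Ile Ieq : {set 'I_m}) (T T' : {set {set 'I_m}}).
Variable tau : nat -> W -> {set 'I_m}.
Hypothesis htau : bmrk_sampling P A T T' tau.

Definition past (k : nat) (w : W) : {ffun 'I_k -> {set 'I_m}} :=
  [ffun i : 'I_k => tau i w].

Lemma past_fiber (k : nat) (h : {ffun 'I_k -> {set 'I_m}}) :
  [set w | past k w = h] =
  [set w | forall i, (i < k)%N -> tau i w = extend_word finset.set0 h i].
Proof.
apply/seteqP; split => [w /= <- i ik|w /= hw].
  by rewrite -[i]/(nat_of_ord (Ordinal ik)) extend_wordE ffunE.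
by apply/ffunP => i; rewrite ffunE hw// extend_wordE.
Qed.

Lemma measurable_past (k : nat) (h : {ffun 'I_k -> {set 'I_m}}) :
  measurable [set w | past k w = h].
Proof.
have -> : [set w | past k w = h] =
    \bigcap_(i in [set: 'I_k]) [set w | tau i w = h i].
  apply/seteqP; split => [w /= <- i _|w hw]; first by rewrite /= ffunE.
  by apply/ffunP => i; rewrite ffunE; exact: hw.
apply: fin_bigcap_measurable => // i _; by have [+ _ _] := htau; apply.
Qed.

Lemma past_indep (k : nat) (h : {ffun 'I_k -> {set 'I_m}}) (s : {set 'I_m}) :
  P ([set w | tau k w = s] `&` [set w | past k w = h]) =
  (P [set w | tau k w = s] * P [set w | past k w = h])%E.
Proof. by rewrite past_fiber; have [_ _] := htau; apply. Qed.

(** The weights |A_s|^2 / |A|^2 of the blocks add up to 1, so every other index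
    set is drawn with probability 0. *)
Lemma sampling_expectation (k : nat) (f : {set 'I_m} -> R) :
  A != 0 -> [disjoint Ile & Ieq]%B -> Ile :|: Ieq = [set: 'I_m]%SET ->
  finset.partition T Ile -> finset.partition T' Ieq ->
  \sum_s fine (P [set w | tau k w = s]) * f s =
  \sum_(s in T :|: T') frob (rows_of s A) ^+ 2 / frob A ^+ 2 * f s.
Proof.
move=> hA hdisj hcover hT hT'; have [mtau ptau _] := htau.
have pE s : s \in T :|: T' -> fine (P [set w | tau k w = s]) =
    frob (rows_of s A) ^+ 2 / frob A ^+ 2 by move=> /ptau ->.
have p0 s : 0 <= fine (P [set w | tau k w = s]) by exact: fine_ge0.
have : \sum_s fine (P [set w | tau k w = s]) = 1.
  have := probability_finite_valued P (mtau k) setT.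
  rewrite preimage_setT probability_setT /= => ->.
  by apply: eq_bigl => s; rewrite in_setT.
rewrite (bigID [in T :|: T']) /= (eq_bigr _ pE) -mulr_suml.
rewrite (sum_blocks_frob_sqr hdisj hcover hT hT') divff; last first.
  by rewrite sqrf_eq0 frob_eq0.
move=> /eqP; rewrite -[eqbRHS]addr0 (inj_eq (addrI _)) psumr_eq0// => /allP out0.
rewrite (bigID [in T :|: T']) /= [X in _ + X]big1 => [|s sT].
  by rewrite addr0; apply: eq_bigr => s sT; rewrite pE.
by have := out0 s (mem_index_enum _); rewrite sT => /eqP ->; rewrite mul0r.
Qed.

End sampling.

(** * Linear convergence in expectation *)

Theorem theorem3p2 (R : realType) (m n p : nat)
    (A : 'M[R]_(m, n)) (B : 'M[R]_(m, p)) (hA : A != 0)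
    (Ile Ieq : {set 'I_m})
    (hdisj : [disjoint Ile & Ieq]%B) (hcover : Ile :|: Ieq = [set: 'I_m]%SET)
    (hfeas : feasible A B Ile Ieq !=set0)
    (T T' : {set {set 'I_m}})
    (hT : finset.partition T Ile) (hT' : finset.partition T' Ieq)
    (t : {set 'I_m} -> R)
    (ht : forall s, s \in T :|: T' -> 0 < t s < 2)
    (L : R) (hL : is_hoffman_constant A B Ile Ieq L)
    (d : measure_display) (W : measurableType d) (P : probability W R)
    (tau : nat -> W -> {set 'I_m}) (htau : bmrk_sampling P A T T' tau)
    (X0 : 'M[R]_(n, p)) (k : nat) :
  let X := fun (j : nat) (w : W) => bmrk A B T T' t X0 (tau ^~ w) j in
  let dist2 := fun (j : nat) (w : W) =>
    frob_dist (X j w) (feasible A B Ile Ieq) ^+ 2 in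
  (exists V : W -> R, is_cond_expectation P (sigma_of (X k)) (dist2 k.+1) V) /\
  (forall V : W -> R,
     is_cond_expectation P (sigma_of (X k)) (dist2 k.+1) V ->
     {ae P, forall w, V w <= (1 - bmrk_gain A T T' t L) * dist2 k w}).
Proof.
move=> X dist2.
pose F (h : {ffun 'I_k -> {set 'I_m}}) :=
  bmrk A B T T' t X0 (extend_word finset.set0 h) k.
pose z (x : 'M[R]_(n, p)) (s : {set 'I_m}) :=
  frob_dist (bmrk_step A B T T' t s x) (feasible A B Ile Ieq) ^+ 2.
have XE : X k = fun w => F (past tau k w).
  apply/funext => w; apply: eq_bmrk => i ik.
  by rewrite -[i]/(nat_of_ord (Ordinal ik)) extend_wordE ffunE.
have dist2E : dist2 k.+1 = fun w => z (F (past tau k w)) (tau k w).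
  by apply/funext => w; rewrite /z -[F _](congr1 (@^~ w) XE).
have [mtau _ _] := htau.
rewrite dist2E XE; split.
  by eexists; exact: (freezing (measurable_past htau (k := k)) (mtau k)
    (past_indep htau (k := k)) F z).
move=> V /(freezing_unique (measurable_past htau (k := k)) (mtau k)
  (past_indep htau (k := k))).
apply: filterS => w ->.
rewrite (sampling_expectation htau k _ hA hdisj hcover hT hT').
have [L0 hoff _] := hL.
have -> : dist2 k w = frob_dist (F (past tau k w)) (feasible A B Ile Ieq) ^+ 2.
  by rewrite /dist2 XE.
exact: bmrk_expected_descent.
Qed.
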